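(* Let $C=C(x)=\frac{1-\sqrt{1-4x}}{2x}=\sum_{n\ge0}\frac{1}{n+1}\binom{2n}{n}x^n$ be the Catalan generating function. For $n\ge2$ and $2\le i\le n$, let $a_{n,i}=a_{n,i}(y)=\sum_{\pi} y^{\mu(\pi)}$, the sum over all $\pi\in\mathcal{D}_{31\text{-}2}(n)$ whose flattened form has second letter $i$, and let $$A(x,v)=\sum_{n\ge2}\Big(\sum_{i=2}^n a_{n,i}v^{i-2}\Big)x^n .$$ Then $$A(x,v)=\frac{x^2y(1-v)}{1-v+xv^2}+\frac{x^2y(1+xy-xyv^2)(C-1)}{(1-v+xv^2)(1-xy(C^2-1))}.$$ Moreover, for $n\ge2$ and $1\le m\le\lfloor n/2\rfloor$, the number of members of $\mathcal{D}_{31\text{-}2}(n)$ with exactly $m$ cycles is $$\frac{2(m-1)}{n-m}\sum_{j=0}^{m-2}(-1)^j\binom{m-2}{j}\binom{2n-2j-3}{n-m-2}+\frac{1}{n-m}\sum_{j=0}^{m-1}(-1)^j\binom{m-1}{j}\binom{2n-2j-2}{n-m-1}.$$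
   Context: Every permutation $\pi$ of $[n]=\{1,\dots,n\}$ is written in standard cycle form: each cycle is written starting with its smallest element, and the cycles are ordered from left to right by increasing first elements. The flattened form $\mathrm{flat}(\pi)$ is the word (in one-line notation) obtained by erasing the parentheses of the standard cycle form; e.g. $(135)(26)(478)$ has flattened form $13526478$. A derangement is a permutation with no fixed points; $\mathcal{D}(n)$ is the set of derangements of $[n]$, and $\mu(\pi)$ denotes the number of cycles of $\pi$. A word $w=w_1\cdots w_n$ of distinct integers contains the vincular pattern $31\text{-}2$ if there are indices $i$ and $k>i+1$ with $w_{i+1}<w_k<w_i$, and avoids it otherwise. $\mathcal{D}_{31\text{-}2}(n)$ is the set of $\pi\in\mathcal{D}(n)$ such that $\mathrm{flat}(\pi)$ avoids $31\text{-}2$. Generating functions are formal power series in $x$ (and $v$) with coefficients polynomials in $y$. *)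

(* Defs.v *)
From HB Require Import structures.
From mathcomp Require Import all_boot all_order all_algebra all_fingroup.
From mathcomp Require Import boolp ring.

Set Implicit Arguments.
Unset Strict Implicit.
Unset Printing Implicit Defensive.

Import Order.TTheory GRing.Theory Num.Theory.
Local Open Scope ring_scope.

(** * Formal power series over a commutative ring

    [Fps a] is the series with coefficient sequence [a]. Multiplication is the
    Cauchy product; [a] is a unit iff its constant coefficient is one, so that
    [/] is the usual quotient of formal power series. Series in two variables
    are obtained by iterating the construction. *)

Record fps (R : Type) := Fps { fcoef : nat -> R }.

Section FpsRing.
Variable R : comUnitRingType.
Implicit Types a b c : fps R.

HB.instance Definition _ := gen_eqMixin (fps R).
HB.instance Definition _ := gen_choiceMixin (fps R).

Lemma fpsP a b : (forall n, fcoef a n = fcoef b n) -> a = b.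
Proof. by case: a b => [a] [b] /= eq_ab; congr Fps; apply/funext. Qed.

Definition fps_add a b : fps R := Fps (fun n => fcoef a n + fcoef b n).
Definition fps_opp a : fps R := Fps (fun n => - fcoef a n).
Definition fpsC (r : R) : fps R := Fps (fun n => if n == 0%N then r else 0).
Definition fpsX : fps R := Fps (fun n => (n == 1%N)%:R).
Definition fps_mul a b : fps R :=
  Fps (fun n => \sum_(i < n.+1) fcoef a i * fcoef b (n - i)%N).

Fact fps_addA : associative fps_add.
Proof. by move=> a b c; apply: fpsP => n /=; rewrite addrA. Qed.
Fact fps_addC : commutative fps_add.
Proof. by move=> a b; apply: fpsP => n /=; rewrite addrC. Qed.
Fact fps_add0 : left_id (fpsC 0) fps_add.
Proof. by move=> a; apply: fpsP => n /=; rewrite if_same add0r. Qed.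
Fact fps_addN : left_inverse (fpsC 0) fps_opp fps_add.
Proof. by move=> a; apply: fpsP => n /=; rewrite if_same addNr. Qed.

HB.instance Definition _ :=
  GRing.isZmodule.Build (fps R) fps_addA fps_addC fps_add0 fps_addN.

Fact fps_mulC : commutative fps_mul.
Proof.
move=> a b; apply: fpsP => n /=; rewrite (reindex_inj rev_ord_inj) /=.
by apply: eq_bigr => i _; rewrite mulrC subSS subKn // -ltnS.
Qed.

Fact fps_mulA : associative fps_mul.
Proof.
move=> a b c; rewrite (fps_mulC b); apply: fpsP => n.
rewrite (fps_mulC (fps_mul a b)) /=.
pose t j k := fcoef a j * (fcoef c k * fcoef b (n - j - k)%N).
transitivity (\sum_(j < n.+1) \sum_(k < n.+1 | (k <= n - j)%N) t j k).
  apply: eq_bigr => /= j _; rewrite big_distrr /=.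
  by rewrite (big_ord_narrow_leq (leq_subr _ _)).
rewrite (exchange_big_dep predT) //=; apply: eq_bigr => k _.
transitivity (\sum_(j < n.+1 | (j <= n - k)%N) t j k).
  apply: eq_bigl => j; rewrite -ltnS -(ltnS j) -!subSn ?leq_ord //.
  by rewrite -subn_gt0 -(subn_gt0 j) -!subnDA addnC.
rewrite (big_ord_narrow_leq (leq_subr _ _)) big_distrr /=.
by apply: eq_bigr => j _; rewrite /t -!subnDA addnC mulrCA.
Qed.

Fact fps_mul1 : left_id (fpsC 1) fps_mul.
Proof.
move=> a; apply: fpsP => n /=; rewrite big_ord_recl /= subn0 mul1r.
by rewrite big1 ?addr0 // => i _; rewrite mul0r.
Qed.

Fact fps_mulDl : left_distributive fps_mul fps_add.
Proof.
move=> a b c; apply: fpsP => n /=; rewrite -big_split /=.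
by apply: eq_bigr => i _; rewrite mulrDl.
Qed.

Fact fps_1neq0 : fpsC 1 != 0 :> fps R.
Proof.
by apply/eqP => /(congr1 (fun a => fcoef a 0%N)) /= /eqP; rewrite oner_eq0.
Qed.

HB.instance Definition _ := GRing.Zmodule_isComNzRing.Build (fps R)
  fps_mulA fps_mulC fps_mul1 fps_mulDl fps_1neq0.

(* The first [n] coefficients of the inverse series, from
   a_0 b_n = [n = 0] - \sum_(i < n) b_i a_(n - i). *)
Fixpoint fps_inv_seq a (n : nat) : seq R :=
  if n is k.+1 then
    let s := fps_inv_seq a k in
    rcons s ((fcoef a 0)^-1
             * ((k == 0%N)%:R - \sum_(i < k) s`_i * fcoef a (k - i)%N))
  else [::].

Definition fps_unit : {pred fps R} := fun a => fcoef a 0 \is a GRing.unit.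

Definition fps_inv a : fps R :=
  if a \in fps_unit then Fps (fun n => (fps_inv_seq a n.+1)`_n) else a.

Lemma size_fps_inv_seq a n : size (fps_inv_seq a n) = n.
Proof. by elim: n => //= n IHn; rewrite size_rcons IHn. Qed.

Lemma nth_fps_inv_seq a n i :
  (i < n)%N -> (fps_inv_seq a n)`_i = (fps_inv_seq a i.+1)`_i.
Proof.
elim: n => // n IHn; rewrite ltnS leq_eqVlt => /predU1P[-> //|lt_in].
by rewrite [LHS]/= nth_rcons size_fps_inv_seq lt_in IHn.
Qed.

Fact fps_mulV : {in fps_unit, left_inverse 1 fps_inv *%R}.
Proof.
move=> a Ua; apply: fpsP => n; rewrite /fps_inv Ua /= big_ord_recr /= subnn.
rewrite nth_rcons size_fps_inv_seq ltnn eqxx mulrC mulVKr //.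
rewrite (eq_bigr (fun i : 'I_n => (fps_inv_seq a n)`_i * fcoef a (n - i)%N)).
  by rewrite addrC subrK; case: eqP.
by move=> i _; rewrite -/(fps_inv_seq a i.+1) (nth_fps_inv_seq a (ltn_ord i)).
Qed.

Fact fps_unitPl a b : b * a = 1 -> fps_unit a.
Proof.
move=> /(congr1 (fun c => fcoef c 0%N)) /=.
by rewrite big_ord1 /= => ba1; apply/unitrPr; exists (fcoef b 0); rewrite mulrC.
Qed.

Fact fps_inv_out : {in [predC fps_unit], fps_inv =1 id}.
Proof. by move=> a; rewrite inE /= /fps_inv => /negPf ->. Qed.

HB.instance Definition _ := GRing.ComNzRing_hasMulInverse.Build (fps R)
  fps_mulV fps_unitPl fps_inv_out.

Lemma fcoefD a b n : fcoef (a + b) n = fcoef a n + fcoef b n. Proof. by []. Qed.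
Lemma fcoefN a n : fcoef (- a) n = - fcoef a n. Proof. by []. Qed.
Lemma fcoefM a b n :
  fcoef (a * b) n = \sum_(i < n.+1) fcoef a i * fcoef b (n - i)%N.
Proof. by []. Qed.
Lemma fcoef1 n : fcoef (1 : fps R) n = (n == 0%N)%:R.
Proof. by rewrite /=; case: eqP. Qed.
Lemma fcoefM0 a b : fcoef (a * b) 0 = fcoef a 0 * fcoef b 0.
Proof. by rewrite fcoefM big_ord1. Qed.
Lemma fps_unitE a : (a \is a GRing.unit) = (fcoef a 0 \is a GRing.unit).
Proof. by []. Qed.

End FpsRing.

Arguments fpsX {R}.

(** * Permutations in standard cycle form

    The element [i : 'I_n] stands for the letter [i + 1] of [n] = {1, ..., n}. *)

Section Permutations.
Variable n : nat.
Implicit Type p : {perm 'I_n}.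

Definition cycle_form p : seq (seq 'I_n) :=
  [seq traject p i #|porbit p i|
    | i <- enum 'I_n & [forall j in porbit p i, (i <= j)%N]].

Definition flat p : seq nat := [seq (val i).+1 | i <- flatten (cycle_form p)].

Definition mu p : nat := #|porbits p|.

Definition derangement p : bool := [forall i, p i != i].

End Permutations.

Definition contains_31_2 (w : seq nat) : bool :=
  [exists i : 'I_(size w), exists k : 'I_(size w),
    (i.+1 < k)%N && (nth 0 w i.+1 < nth 0 w k < nth 0 w i)%N].

Definition D31_2 (n : nat) : {set {perm 'I_n}} :=
  [set p | derangement p & ~~ contains_31_2 (flat p)].

(** * Generating functions

    The variable y is the indeterminate of [{poly rat}]; series in x and v have
    type [fps (fps {poly rat})], with x the outer and v the inner variable. *)

Definition series : comUnitRingType := fps (fps {poly rat}).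

Definition sx : series := fpsX.
Definition sv : series := fpsC fpsX.
Definition sy : series := fpsC (fpsC 'X).

Definition catalan (n : nat) : rat := 'C(2 * n, n)%:R / n.+1%:R.

Definition Cat : series := Fps (fun n => fpsC (catalan n)%:P).

Definition a_ (n i : nat) : {poly rat} :=
  \sum_(p in D31_2 n | nth 0%N (flat p) 1 == i) 'X ^+ mu p.

Definition A : series :=
  Fps (fun n => if (2 <= n)%N
                then \sum_(2 <= i < n.+1) fpsC (a_ n i) * fpsX ^+ (i - 2)
                else 0).

(* Since [a^-1 = a] outside the units, quotients by these two series are
   meaningful only because of the next two lemmas. *)

Lemma denom1_unit : 1 - sv + sx * sv ^+ 2 \is a GRing.unit.
Proof.
rewrite fps_unitE !fcoefD fcoefN fcoefM0 mul0r addr0 fps_unitE fcoefD fcoefN /=.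
by rewrite subr0 unitr1.
Qed.

Lemma denom2_unit : 1 - sx * sy * (Cat ^+ 2 - 1) \is a GRing.unit.
Proof. by rewrite fps_unitE fcoefD fcoefN !fcoefM0 !mul0r subr0 unitr1. Qed.

Lemma catalanS n : n.+2%:R * catalan n.+1 = (4 * n + 2)%:R * catalan n.
Proof.
have nz k : k.+1%:R != 0 :> rat by rewrite pnatr_eq0.
have E : (n.+1 * 'C(2 * n.+1, n.+1) = (4 * n + 2) * 'C(2 * n, n))%N.
  have -> : (4 * n + 2 = 2 * (2 * n).+1)%N by rewrite mulnS mulnA addnC.
  have := mul_bin_down (2 * n).+1 n; have := mul_bin_diag (2 * n).+2 n.
  rewrite /= mulnS => <- E; rewrite -mulnA E subSn ?leq_pmull //.
  by rewrite mul2n -addnn addnK mulnA -!addnS mul2n -addnn addnS.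
rewrite /catalan mulrCA divff // mulr1; apply: (mulfI (nz n)).
by rewrite -natrM E mulrCA [X in _ * X]mulrCA divff // mulr1 natrM.
Qed.

Lemma fps_sqr_rec (R : comUnitRingType) (f : fps R) :
  (forall n, n.+1%:R * fcoef f n.+1 = (4 * n%:R - 2) * fcoef f n) ->
  forall n, n.+1%:R * fcoef (f ^+ 2) n.+1 = 4 * (n%:R - 1) * fcoef (f ^+ 2) n.
Proof.
move=> frec n; rewrite expr2 !fcoefM.
pose T n := \sum_(i < n.+1) i%:R * (fcoef f i * fcoef f (n - i)%N).
have T2 k : 2 * T k = k%:R * \sum_(i < k.+1) fcoef f i * fcoef f (k - i)%N.
  rewrite mulr2n mulrDl mul1r {2}/T (reindex_inj rev_ord_inj) /= -big_split /=.
  rewrite mulr_sumr; apply: eq_bigr => i _; have ik : (i <= k)%N by rewrite -ltnS.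
  by rewrite subSS subKn // natrB //; ring.
rewrite -T2 {1}/T big_ord_recl /= mul0r add0r.
transitivity (2 * (\sum_(i < n.+1) (4 * (i%:R * (fcoef f i * fcoef f (n - i)%N))
                 - 2 * (fcoef f i * fcoef f (n - i)%N)))).
  congr (_ * _); apply: eq_bigr => i _.
  by rewrite /bump /= add1n subSS mulrA frec; ring.
rewrite sumrB -!mulr_sumr -/(T n) mulrBr mulrCA T2; ring.
Qed.

(* C = (1 - sqrt(1 - 4x)) / (2x), the square root being the one with constant
   coefficient 1. *)
Lemma catalan_sqrt :
  (1 - 2 * sx * Cat) ^+ 2 = 1 - 4 * sx /\ fcoef (1 - 2 * sx * Cat) 0 = 1.
Proof.
set S := 1 - _.
have fpsC1 : fpsC 1%:P = 1 :> fps {poly rat} by rewrite polyC1.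
have natC k (c : rat) : k%:R * fpsC c%:P = fpsC (k%:R * c)%:P.
  rewrite !mulr_natl polyCMn; elim: k => [|k IHk] /=; apply: fpsP => j /=.
    by rewrite mulr0n if_same.
  by rewrite mulrS IHk /= mulrS; case: ifP; rewrite ?addr0.
have cx (a : series) n : fcoef (sx * a) n.+1 = fcoef a n.
  rewrite fcoefM !big_ord_recl /= mul0r add0r /bump /= mul1r subSS subn0.
  by rewrite big1 ?addr0 // => i _; rewrite mul0r.
have cnat k (a : series) n : fcoef (k%:R * a) n = k%:R * fcoef a n.
  rewrite !mulr_natl; elim: k => [|k IHk]; first by rewrite !mulr0n /= if_same.
  by rewrite !mulrS fcoefD IHk.
have cx0 (a : series) : fcoef (sx * a) 0 = 0 by rewrite fcoefM0 mul0r.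
have S0 : fcoef S 0 = 1.
  by rewrite fcoefD fcoefN -mulrA cnat cx0 mulr0 subr0.
have S1 n : fcoef S n.+1 = - (2 * fpsC (catalan n)%:P).
  by rewrite fcoefD fcoefN -mulrA cnat cx fcoef1 sub0r.
split=> //.
have frec n : n.+1%:R * fcoef S n.+1 = (4 * n%:R - 2) * fcoef S n.
  case: n => [|n]; rewrite ?S1.
    have -> : catalan 0 = 1 by rewrite /catalan bin0 divr1.
    by rewrite S0 fpsC1; ring.
  have := natC n.+2 (catalan n.+1); rewrite catalanS -natC => E.
  rewrite mulrN mulrCA E natrD natrM -[n.+1]addn1 natrD; ring.
have Unat n : (n.+1%:R : fps {poly rat}) \is a GRing.unit.
  have -> : n.+1%:R = fpsC (n.+1%:R)%:P :> fps {poly rat}.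
    by have := natC n.+1 1; rewrite fpsC1 !mulr1.
  by rewrite fps_unitE /= poly_unitE size_polyC coefC pnatr_eq0 /= unitfE pnatr_eq0.
have grec := fps_sqr_rec frec.
have g0 : fcoef (S ^+ 2) 0 = 1 by rewrite expr2 fcoefM0 S0 mulr1.
have g1 : fcoef (S ^+ 2) 1 = -4.
  by have := grec 0%N; rewrite g0 mul1r => ->; ring.
have gS n : fcoef (S ^+ 2) n.+2 = 0.
  elim: n => [|n IHn].
    by apply: (mulrI (Unat 1%N)); rewrite grec subrr !mulr0 mul0r.
  by apply: (mulrI (Unat n.+2)); rewrite grec IHn !mulr0.
apply: fpsP => n; rewrite fcoefD fcoefN cnat.
case: n => [|[|n]].
- by rewrite g0 /= mulr0 subr0.
- by rewrite g1 /= mulr1 sub0r.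
- by rewrite gS /= mulr0 subr0.
Qed.

(* Main.v *)
(** The standard cycle form of a permutation is its flattened word together with
    the positions where cycles start; these positions are arbitrary
    right-to-left minima, including the first letter. The permutation is a
    derangement when no two starts are adjacent and the last letter is not a
    start. Prepending a letter [a] to a 31-2-avoiding word with first letter [b]
    keeps it avoiding iff, after standardization, [a <= b + 1], and the new
    letter is a right-to-left minimum iff it is the smallest one. Hence, with
    F(x, v) recording length and first letter of the avoiding words whose first
    letter is not a start,
      (1 - v + x v^2) F(x, v) = x (1 - v) + x F(x, 1) (1 + x y (1 - v^2)),
    and A = x y F. The kernel vanishes at v = C, which gives
    F(x, 1) = (C - 1) / (1 - x y (C^2 - 1)). The coefficient of y^m then follows
    from Lagrange inversion applied to (C - 1) (C^2 - 1)^(m - 1). *)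

From HB Require Import structures.
Require Import Defs.
From mathcomp Require Import all_boot all_order all_algebra all_fingroup.
From mathcomp Require Import zify ring.
Import GRing.Theory.
Local Open Scope ring_scope.

Set Implicit Arguments.
Unset Strict Implicit.
Unset Printing Implicit Defensive.

(** * Words *)

(** The first two letters are tested in the role of 31 against all later letters; the recursive call
    treats the remaining adjacent pairs. *)
Fixpoint avoids (w : seq nat) : bool :=
  if w is a :: u
  then ~~ has (fun x => head a u < x < a)%N u && avoids u else true.

Lemma contains_31_2E w : contains_31_2 w = ~~ avoids w.
Proof.
have conP s : reflect
    (exists i k, [/\ (i.+1 < k)%N, (k < size s)%N
                   & (nth 0 s i.+1 < nth 0 s k < nth 0 s i)%N])
    (contains_31_2 s).
  apply: (iffP existsP) => [[i /existsP[k /andP[ik H]]]|[i [k [ik ks H]]]].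
    by exists i, k; split.
  have is' : (i < size s)%N by lia.
  by exists (Ordinal is'); apply/existsP; exists (Ordinal ks); apply/andP.
elim: w => [|a u IHu]; first by apply/conP => -[i [k []]].
rewrite [avoids _]/= negb_and negbK -IHu.
apply/conP/orP => [[[|i] [[|k] [ik ks H]]]|[/hasP[x xu H]|/conP[i [k [ik ks H]]]]].
- by [].
- left; apply/hasP; exists (nth 0 u k); first by rewrite mem_nth.
  by move: H => /=; case: u {IHu} ks.
- by [].
- by right; apply/conP; exists i, k; split.
- exists 0%N, (index x u).+1; rewrite /= nth_index // !ltnS index_mem xu.
  case: u {IHu} xu H => //= b t _ H; split=> //.
  by case: eqP => // bx; move: H; rewrite bx ltnn.
- by exists i.+1, k.+1; split.
Qed.

(* [weights w] sums y^(number of marks) over the markings of [w] in which only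
   right-to-left minima are marked, no two marks are adjacent and the last
   letter is unmarked; the first component collects the markings with unmarked
   first letter, the second one those with marked first letter. The values at
   [[::]] are chosen to make the recursion uniform. *)
Fixpoint weights (w : seq nat) : {poly rat} * {poly rat} :=
  if w is a :: u
  then ((weights u).1 + (weights u).2,
        if all (ltn a) u then 'X * (weights u).1 else 0)
  else (0, 1).

(** * Decompositions of a word into consecutive blocks *)

Section Decompositions.
Variable T : eqType.
Implicit Types (w : seq T) (s : seq (seq T)).

(** The first letter either forms a block alone or joins the first block of a decomposition of the
    tail, so each cut into nonempty blocks appears once. *)
Fixpoint decs w : seq (seq (seq T)) :=
  if w is a :: u
  then [seq [:: a] :: s | s <- decs u]
       ++ [seq (a :: head [::] s) :: behead s | s <- decs u & s != [::]]
  else [:: [::]].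

Lemma mem_decs w s : (s \in decs w) = (flatten s == w) && ([::] \notin s).
Proof.
elim: w s => [|a u IHu] s /=.
  rewrite inE; case: s => [|[|b h] t] //=; rewrite ?inE ?eqxx ?andbF //.
rewrite mem_cat; apply/orP/andP => [[/mapP[r ru ->]|/mapP[r]]|[]].
- by move: ru; rewrite IHu inE /= => /andP[/eqP -> ->]; rewrite eqxx.
- rewrite mem_filter IHu; case: r => //= h t /andP[/eqP <- nn] ->.
  by move: nn; rewrite eqxx !inE negb_or => /andP[_ ->].
- case: s => [|[|b [|c h]] t] //=; rewrite !inE //= eqseq_cons => /andP[/eqP -> fu] nt.
    by left; apply/mapP; exists t => //; rewrite IHu fu.
  right; apply/mapP; exists ((c :: h) :: t) => //.
  by rewrite mem_filter IHu /= inE /= fu.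
Qed.

Lemma decs_uniq w : uniq (decs w).
Proof.
elim: w => //= a u IHu; rewrite cat_uniq map_inj_uniq ?IHu; last by move=> ? ? [].
rewrite map_inj_in_uniq ?filter_uniq ?andbT //; last first.
  by move=> [|h t] [|h' t']; rewrite !mem_filter //= => _ _ [-> ->].
apply/hasPn => z /mapP[r]; rewrite mem_filter mem_decs => /andP[nr /andP[_ rr]] ->{z}.
apply/mapP => -[q _ [r0 _]]; case: r nr rr r0 => //= h t _ + h0.
by rewrite h0 inE.
Qed.

End Decompositions.

(** Requiring each head to lie below everything after it, in its own block and in later ones,
    encodes at once that cycles start with their minimum and that heads increase. *)
Fixpoint derangement_form (s : seq (seq nat)) : bool :=
  if s is c :: t
  then [&& (1 < size c)%N, all (ltn (head 0%N c)) (behead c ++ flatten t)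
         & derangement_form t]
  else true.

(** Marks are block starts. When the first letter is unmarked, the first block is the end of a cycle
    begun further left: it is neither constrained nor counted. *)
Lemma sum_decs w :
  \sum_(s <- decs w | (s != [::]) && derangement_form (behead s)) 'X ^+ (size s).-1
    = (weights w).1
  /\ \sum_(s <- decs w | derangement_form s) 'X ^+ size s = (weights w).2.
Proof.
elim: w => [|a u [IHU IHM]] /=.
  by split; rewrite big_mkcond big_seq1 /= ?expr0.
split.
  rewrite big_cat /= addrC; congr (_ + _).
    rewrite big_map big_filter_cond -IHU; apply: eq_big => [[|h t]|[|h t] _] //=.
  by rewrite big_map -IHM.
(* A leading block [[:: a]] would be a fixed point, so these decompositions contribute nothing. *)
rewrite big_cat /= [X in X + _]big1_seq ?add0r; last first.
  by move=> s /andP[+ /mapP[r _ sE]]; rewrite sE.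
rewrite big_map big_filter_cond /=; case: ifP => au.
  rewrite -IHU mulr_sumr big_seq_cond [RHS]big_seq_cond; apply: eq_big => s.
    case sd : (s \in decs u) => //=; case: s sd => //= h t.
    rewrite mem_decs => /andP[/eqP /= hu]; rewrite inE negb_or => /andP[nh _].
    by rewrite hu -[all (fun n => _) u]/(all (ltn a) u) au; case: (h) nh.
  by move=> /and3P[_]; case: s => //= h t _ _; rewrite exprS.
rewrite big1_seq // => -[|h t] //= /andP[/and3P[_ + _] sd]; move: sd.
rewrite mem_decs => /andP[/eqP /= -> _].
by rewrite -[all (fun n => _) u]/(all (ltn a) u) au.
Qed.

(** * Invariance under order-preserving relabelling, and standardization *)

Section IncreasingMaps.
Variable f : nat -> nat.
Hypothesis f_incr : {mono f : x y / (x < y)%N}.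

Lemma avoids_map w : avoids (map f w) = avoids w.
Proof.
elim: w => //= a u ->; congr (~~ _ && _).
rewrite has_map; apply: eq_has => x /=.
by case: u => [|b u] /=; rewrite !f_incr.
Qed.

Lemma weights_map w : weights (map f w) = weights w.
Proof.
elim: w => //= a u ->; congr (_, _); rewrite all_map.
by rewrite (eq_all (a2 := ltn a)) // => x /=; rewrite f_incr.
Qed.

End IncreasingMaps.

Lemma bump_ltn_mono a : {mono bump a : x y / (x < y)%N}.
Proof. by move=> x y; rewrite /bump; lia. Qed.

(** A word is its first letter [a] together with its standardized tail; [bump a] reopens the gap at
    [a]. *)
Lemma permutations_iotaS n :
  perm_eq (permutations (iota 0 n.+1))
    [seq a :: map (bump a) u | a <- iota 0 n.+1, u <- permutations (iota 0 n)].
Proof.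
have binj a : injective (bump a) by exact: (can_inj (bumpK a)).
apply: uniq_perm; first exact: permutations_uniq.
  apply: allpairs_uniq; rewrite ?iota_uniq ?permutations_uniq //.
  by move=> [a u] [b t] _ _ /= [-> /inj_map ->].
have mem_iff w m : (w \in permutations (iota 0 m))
    = uniq w && [forall x : 'I_m, (x : nat) \in w] && (size w == m).
  rewrite mem_permutations; apply/idP/andP => [pw|[/andP[uw /forallP mw] /eqP sw]].
    split; last by rewrite (perm_size pw) size_iota.
    rewrite (perm_uniq pw) iota_uniq /=; apply/forallP => x.
    by rewrite (perm_mem pw) mem_iota /=.
  rewrite perm_sym; apply: uniq_perm => //; first exact: iota_uniq.
  have [||//] := uniq_min_size (iota_uniq 0 m) (s2 := w).
    by move=> x; rewrite mem_iota add0n /= => xm; exact: (mw (Ordinal xm)).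
  by rewrite sw size_iota.
move=> w; rewrite mem_permutations; apply/idP/allpairsP => [pw|[[a u] [an pu ->]]].
  have sw : size w = n.+1 by rewrite (perm_size pw) size_iota.
  case: w sw pw => // a u [su] pw; exists (a, map (unbump a) u) => /=.
  have uq : uniq (a :: u) by rewrite (perm_uniq pw) iota_uniq.
  have an : a \in iota 0 n.+1 by rewrite -(perm_mem pw) mem_head.
  have uE : map (bump a) (map (unbump a) u) = u.
    rewrite -map_comp map_id_in // => x xu; rewrite /= unbumpK //.
    by apply: contraNneq (andP uq).1 => <-.
  rewrite uE; split=> //; rewrite mem_iff size_map su eqxx andbT; apply/andP; split.
    by rewrite -(map_inj_uniq (binj a)) uE; case/andP: uq.
  apply/forallP => x; rewrite -(mem_map (binj a)) uE.
  have := perm_mem pw (bump a x).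
  rewrite mem_iota inE [_ == a]eq_sym (negPf (neq_bump _ _)) /=.
  by move=> ->; rewrite /bump; have := ltn_ord x; lia.
have {}an : a \in iota 0 n.+1 := an.
have {}pu : perm_eq u (iota 0 n) by rewrite -mem_permutations.
have nau : a \notin map (bump a) u.
  by apply/mapP => -[x _ /eqP]; rewrite (negPf (neq_bump _ _)).
rewrite -mem_permutations mem_iff /= nau map_inj_uniq // size_map (perm_size pu) size_iota.
rewrite eqxx (perm_uniq pu) iota_uniq andbT; apply/forallP => x; rewrite inE.
case: eqP => //= /eqP nxa; apply/mapP; exists (unbump a x); last by rewrite unbumpK.
rewrite (perm_mem pu) mem_iota /=; move: an; rewrite mem_iota /unbump.
by have := ltn_ord x; move: nxa; lia.
Qed.

(** * Standard cycle form *)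

Lemma uniq_flatten_map (S T : eqType) (F : S -> seq T) (s : seq S) :
    uniq s -> {in s, forall i, uniq (F i)} ->
    {in s &, forall i j x, x \in F i -> x \in F j -> i = j} ->
  uniq (flatten (map F s)).
Proof.
elim: s => //= i s IHs /andP[nis us] uF dF; rewrite cat_uniq uF ?mem_head //=.
rewrite IHs // ?andbT; first last.
- by move=> j k js ks; apply: dF; rewrite inE ?js ?ks orbT.
- by move=> j js; apply: uF; rewrite inE js orbT.
apply/hasPn => x /flattenP[_ /mapP[j js ->] xj]; apply/negP => xi.
by case/negP: nis; rewrite (dF i j _ _ x) // inE ?eqxx ?js ?orbT.
Qed.

Lemma uniq_flatten_inj (T : eqType) (s : seq (seq T)) (c d : seq T) (x : T) :
  uniq (flatten s) -> c \in s -> d \in s -> x \in c -> x \in d -> c = d.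
Proof.
elim: s => //= b s IHs; rewrite cat_uniq => /and3P[_ /hasPn dis us].
have nin e : e \in s -> x \in e -> x \notin b.
  by move=> es xe; apply: dis; apply/flattenP; exists e.
rewrite !inE => /predU1P[->|cs] /predU1P[->|ds] xc xd //.
- by move: (nin d ds xd); rewrite xc.
- by move: (nin c cs xc); rewrite xd.
- exact: IHs.
Qed.

Lemma uniq_flatten_block (T : eqType) (s : seq (seq T)) (c : seq T) :
  uniq (flatten s) -> c \in s -> uniq c.
Proof.
elim: s => //= b s IHs; rewrite cat_uniq => /and3P[ub _ us].
by rewrite inE => /predU1P[->|/IHs ->].
Qed.

Lemma derangement_form_head_min s c x :
  derangement_form s -> c \in s -> x \in c -> (head 0%N c <= x)%N.
Proof.
elim: s => //= d s IHs /and3P[sd ad std]; rewrite inE => /predU1P[->|/IHs]; last exact.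
case: d sd ad => //= a h _ /allP ad; rewrite inE => /predU1P[->//|xh].
by apply/ltnW/ad; rewrite mem_cat xh.
Qed.

Lemma derangement_form_heads_sorted s :
  derangement_form s -> sorted ltn (map (head 0%N) s).
Proof.
elim: s => //= c s IHs /and3P[_ /allP ac std]; move: (IHs std).
case: s ac std {IHs} => //= d s ac /andP[sd _] ->; rewrite andbT.
apply: ac; rewrite mem_cat; apply/orP; right.
by case: d sd => //= b d _; rewrite mem_head.
Qed.

Section CycleForm.
Variable n : nat.
Implicit Types (p q : {perm 'I_n.+1}) (i j x : 'I_n.+1).

Definition cycle_min p i : bool := [forall j in porbit p i, (i <= j)%N].

Lemma cycle_minP p i :
  reflect (forall j, j \in porbit p i -> (i <= j)%N) (cycle_min p i).
Proof. exact: forall_inP. Qed.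

Lemma cycle_min_inj p i j x : cycle_min p i -> cycle_min p j ->
  x \in porbit p i -> x \in porbit p j -> i = j.
Proof.
move=> /cycle_minP mi /cycle_minP mj xi xj.
have E : porbit p i = porbit p j.
  by move: xi xj; rewrite -!eq_porbit_mem => /eqP <- /eqP.
have ij : (i <= j)%N by apply: mi; rewrite E porbit_id.
have ji : (j <= i)%N by apply: mj; rewrite -E porbit_id.
by apply/val_inj/eqP; rewrite eqn_leq ij ji.
Qed.

Lemma cycle_min_ex p x : exists2 i, cycle_min p i & x \in porbit p i.
Proof.
case: (@arg_minnP _ x (mem (porbit p x)) val (porbit_id p x)) => i ix im.
exists i; last by rewrite porbit_sym.
apply/cycle_minP => j ji; apply: im; rewrite inE.
by have /eqP <- : porbit p i == porbit p x by rewrite eq_porbit_mem.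
Qed.

Lemma mem_cycle_form p c : c \in cycle_form p ->
  exists2 i, cycle_min p i & c = traject p i #|porbit p i|.
Proof. by case/mapP => i; rewrite mem_filter => /andP[mi _] ->; exists i. Qed.

Lemma cycle_form_cover p x : exists2 c, c \in cycle_form p & x \in c.
Proof.
have [i mi xi] := cycle_min_ex p x.
exists (traject p i #|porbit p i|); last by rewrite -porbit_traject.
by apply/mapP; exists i => //; rewrite mem_filter mem_enum andbT.
Qed.

Lemma cycle_form_perm p : perm_eq (flatten (cycle_form p)) (enum 'I_n.+1).
Proof.
apply: uniq_perm; last 1 first.
- move=> x; rewrite mem_enum; apply/flattenP.
  by have [c cp xc] := cycle_form_cover p x; exists c.
- apply: uniq_flatten_map => [|i _|i j].
  - exact: filter_uniq (enum_uniq _).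
  - exact: uniq_traject_porbit.
  rewrite !mem_filter => /andP[mi _] /andP[mj _] x.
  by rewrite -!porbit_traject; apply: cycle_min_inj.
exact: enum_uniq.
Qed.

(** Each orbit contains exactly one minimum, so the starts of the cycle form index the orbits. *)
Lemma size_cycle_form p : size (cycle_form p) = mu p.
Proof.
rewrite size_map /mu.
have -> : porbits p = porbit p @: [set i | cycle_min p i].
  apply/setP => O; apply/imsetP/imsetP => [[x _ ->]|[x _ ->]]; last by exists x.
  have [i mi xi] := cycle_min_ex p x; exists i; rewrite ?inE //.
  by apply/eqP; rewrite eq_porbit_mem.
rewrite card_in_imset => [|i j]; last first.
  rewrite !inE => mi mj E; apply: (cycle_min_inj mi mj (porbit_id p i)).
  by rewrite -E porbit_id.
have /card_uniqP <- := filter_uniq (cycle_min p) (enum_uniq 'I_n.+1).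
by apply: eq_card => i; rewrite mem_filter mem_enum inE andbT.
Qed.

(** Each listed trajectory closes up under [p], so [p] is the cyclic successor in its block. This is
    why the cycle form determines [p]. *)
Lemma cycle_form_next p c x : c \in cycle_form p -> x \in c -> p x = next c x.
Proof.
move=> /mem_cycle_form[i _ cE] xc; apply/eqP.
suff : fcycle p c by move/next_cycle; apply.
have := iter_porbit p i; rewrite cE; case: #|_| => //= m pm.
by rewrite rcons_path fpath_traject /= last_traject pm.
Qed.

Lemma cycle_form_inj : injective (@cycle_form n.+1).
Proof.
move=> p q E; apply/permP => x; have [c cp xc] := cycle_form_cover p x.
by rewrite (cycle_form_next cp xc) (@cycle_form_next q c) -?E.
Qed.

(** Letters start at 0 here; [flat] is recovered by applying [succn]. *)
Definition nat_cycles p : seq (seq nat) := map (map val) (cycle_form p).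

Lemma derangement_form_nat_cycles p :
  derangement_form (nat_cycles p) = derangement p.
Proof.
apply/idP/forallP => [std x|der].
  apply/eqP => px; have m1 : #|porbit p x| = 1%N.
    move: (uniq_traject_porbit p x) (card_porbit_neq0 p x).
    by case: #|_| => [|[|m]] //=; rewrite px inE eqxx.
  have mx : cycle_min p x.
    by apply/cycle_minP => j; rewrite porbit_traject m1 inE => /eqP ->.
  have : [:: val x] \in nat_cycles p.
    apply/mapP; exists [:: x] => //; apply/mapP; exists x; last by rewrite m1.
    by rewrite mem_filter mem_enum andbT.
  elim: (nat_cycles p) std => //= c s IHs /and3P[sc _ std].
  by rewrite inE => /predU1P[cE|/(IHs std)] //; move: sc; rewrite -cE.
rewrite /nat_cycles /cycle_form.
(* Induction along the increasing enumeration: the minima of later cycles then exceed the current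
   one. *)
have : sorted ltn (map val (enum 'I_n.+1)) by rewrite val_enum_ord iota_ltn_sorted.
elim: (enum _) => //= i s IHs pis; have {IHs}IHs := IHs (path_sorted pis).
rewrite -/(cycle_min p i); case: ifP => //= mi; rewrite {}IHs andbT.
rewrite size_map size_traject.
have sz : (1 < #|porbit p i|)%N.
  have := mem_porbit p 1 i; rewrite expg1 porbit_traject.
  case: #|_| => [|[|m]] //=; rewrite inE => /eqP pi; move: (der i).
  by rewrite pi eqxx.
rewrite sz /=; apply/allP => y; rewrite mem_cat.
have -> : head 0%N (map val (traject p i #|porbit p i|)) = i by case: #|_| sz.
case/orP => [|/flattenP[_ /mapP[_ /mapP[j + ->] ->]] /mapP[z + ->]].
  have := porbit_traject p i; have := uniq_traject_porbit p i.
  case: #|_| sz => //= m _ /andP[nit _] pE /mapP[z zt ->].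
  rewrite ltn_neqAle (cycle_minP _ _ mi) ?pE ?inE ?zt ?orbT // andbT.
  by apply: contra nit => /eqP/ord_inj {1}->.
(* A letter of a later cycle is at least its minimum [j], and [j] exceeds [i] by the enumeration
   order. *)
rewrite mem_filter => /andP[/cycle_minP mj js]; rewrite -porbit_traject => /mj.
apply: leq_trans; move: pis; rewrite path_sortedE; last exact: ltn_trans.
by case/andP => /allP + _; apply; rewrite map_f.
Qed.

(** The permutation sought sends each letter to its cyclic successor in the block containing it. *)
Lemma derangement_form_cycle_form (t : seq (seq 'I_n.+1)) :
    perm_eq (flatten t) (enum 'I_n.+1) -> derangement_form (map (map val) t) ->
  exists p, cycle_form p = t.
Proof.
move=> pt std.
have ut : uniq (flatten t) by rewrite (perm_uniq pt) enum_uniq.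
have cov x : exists2 c, c \in t & x \in c.
  by apply/flattenP; rewrite (perm_mem pt) mem_enum.
pose blk x := nth [::] t (find (fun c => x \in c) t).
have blkP x : blk x \in t /\ x \in blk x.
  have hx : has (fun c => x \in c) t by have [c ct xc] := cov x; apply/hasP; exists c.
  by split; [rewrite mem_nth // -has_find | exact: (nth_find [::] hx)].
have blkE c x : c \in t -> x \in c -> blk x = c.
  by move=> ct xc; have [bt xb] := blkP x; exact: (uniq_flatten_inj ut bt ct xb xc).
pose f x := next (blk x) x.
have fE c x : c \in t -> x \in c -> f x = next c x.
  by move=> ct xc; rewrite /f (blkE c).
have f_inj : injective f.
  move=> x y; have [bt xb] := blkP x; have [bt' yb] := blkP y; rewrite /f => E.
  have yb' : next (blk x) x \in blk y by rewrite E mem_next.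
  have bE : blk x = blk y by apply: (uniq_flatten_inj ut bt bt' _ yb'); rewrite mem_next.
  rewrite bE in E; exact: (can_inj (prev_next (uniq_flatten_block ut bt')) E).
pose p := perm f_inj.
have pE c x : c \in t -> x \in c -> p x = next c x by move=> ct xc; rewrite permE (fE c).
have shd c : c \in t -> (1 < size c)%N.
  elim: (t) std => //= d s IHs /and3P[+ _ /IHs sP]; rewrite size_map inE => sd.
  by case/predU1P => [->|].
have cne c : c \in t -> head ord0 c \in c.
  by move=> /shd; case: c => //= a h _; rewrite mem_head.
have tr0 c : c \in t -> c = traject p (head ord0 c) (size c).
  move=> ct; have uc := uniq_flatten_block ut ct.
  have := cycle_next uc; rewrite (@eq_in_cycle _ (mem c) _ (frel p)); first last.
  - exact/allP.
  - by move=> x y xc _ /=; rewrite (pE c).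
  by case: c ct (shd c) {uc} => [/shd //|a h ct _] /fcycle_consE.
(* The orbit of the head of a block is the whole block, so the blocks are the cycles of [p]. *)
have porb c : c \in t -> porbit p (head ord0 c) =i c.
  move=> ct x; apply/porbitP/idP => [[k ->]|].
    elim: k => [|k IHk]; first by rewrite expg0 perm1 cne.
    by rewrite expgSr permM (pE c) // mem_next.
  by rewrite {1}(tr0 c ct) => /trajectP[k _ ->]; exists k; rewrite permX.
have tr c : c \in t -> traject p (head ord0 c) #|porbit p (head ord0 c)| = c.
  move=> ct; have /card_uniqP cc := uniq_flatten_block ut ct.
  by rewrite (eq_card (porb c ct)) cc -tr0.
have hval c : c \in t -> head 0%N (map val c) = head ord0 c by case: c => [/shd|].
have hmin c x : c \in t -> x \in c -> (head ord0 c <= x)%N.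
  by move=> ct xc; rewrite -hval // (derangement_form_head_min std) // map_f.
exists p; rewrite /cycle_form.
(* Both lists are strictly increasing, so it suffices that they have the same members. *)
have -> : [seq i <- enum 'I_n.+1 | cycle_min p i] = map (head ord0) t.
  apply: (inj_map val_inj); apply: (irr_sorted_eq ltn_trans ltnn).
  - rewrite sorted_map; apply: sorted_filter; first by move=> ? ? ?; exact: ltn_trans.
    by rewrite -sorted_map val_enum_ord iota_ltn_sorted.
  - have := derangement_form_heads_sorted std; rewrite -map_comp.
    congr (sorted ltn _); rewrite -[RHS]map_comp; apply/eq_in_map => c ct /=.
    exact: hval.
  apply: eq_mem_map => i; rewrite mem_filter mem_enum andbT.
  apply/cycle_minP/mapP => [mi|[c ct -> j]]; last by rewrite porb // => /hmin; apply.
  have [c ct ic] := cov i; exists c => //; apply/val_inj/eqP.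
  by rewrite eqn_leq hmin // mi // porbit_sym porb.
rewrite -map_comp map_id_in // => c ct /=; exact: tr.
Qed.
End CycleForm.

(** * Counting avoiding words by first letter *)

Lemma nat_cycles_inj n : injective (@nat_cycles n).
Proof. by move=> p q /(inj_map (inj_map val_inj)) /cycle_form_inj. Qed.

Lemma flat_nat_cycles n (p : {perm 'I_n.+1}) :
  flat p = map succn (flatten (nat_cycles p)).
Proof. by rewrite /flat /nat_cycles -map_flatten -map_comp. Qed.

Lemma mem_nat_cycles n (s : seq (seq nat)) : derangement_form s ->
  (s \in codom (@nat_cycles n)) = perm_eq (flatten s) (iota 0 n.+1).
Proof.
move=> std; apply/codomP/idP => [[p ->]|ps].
  by rewrite /nat_cycles -map_flatten -val_enum_ord perm_map ?cycle_form_perm.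
pose t : seq (seq 'I_n.+1) := map (map inord) s.
have ts : map (map val) t = s.
  rewrite -map_comp map_id_in // => c cs /=; rewrite -map_comp map_id_in // => x xc.
  rewrite /= inordK //; have : x \in flatten s by apply/flattenP; exists c.
  by rewrite (perm_mem ps) mem_iota.
have [||p pt] := @derangement_form_cycle_form n t; rewrite ?ts //.
  apply: (perm_map_inj val_inj); rewrite map_flatten.
  by rewrite ts val_enum_ord.
by exists p; rewrite /nat_cycles pt ts.
Qed.

(** Derangements are grouped by their flattened word: those with word [w] are the decompositions of
    [w] in derangement form, which [sum_decs] counts. *)
Lemma sum_derangements n (Q : pred (seq nat)) :
  \sum_(p : {perm 'I_n.+1} | derangement p && Q (flatten (nat_cycles p)))
     'X ^+ mu p
  = \sum_(w <- permutations (iota 0 n.+1) | Q w) (weights w).2.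
Proof.
transitivity (\sum_(s <- [seq nat_cycles p | p <- enum (@derangement n.+1)]
                 | Q (flatten s)) 'X ^+ size s : {poly rat}).
  rewrite big_map big_enum_cond /=; apply: eq_big => [p|p _]; first by [].
  by rewrite size_map size_cycle_form.
have -> : \sum_(w <- permutations (iota 0 n.+1) | Q w) (weights w).2
    = \sum_(s <- [seq s <- flatten (map (@decs _) (permutations (iota 0 n.+1)))
                 | derangement_form s] | Q (flatten s)) 'X ^+ size s.
  rewrite big_filter_cond big_flatten big_map [LHS]big_mkcond; apply: eq_bigr => w _.
  have fw s : s \in decs w -> flatten s = w by rewrite mem_decs => /andP[/eqP].
  rewrite -(sum_decs w).2; case: ifP => Qw.
    rewrite big_seq_cond [RHS]big_seq_cond; apply: eq_bigl => s.
    by case sw: (s \in decs w); rewrite //= (fw s) // Qw andbT.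
  by rewrite big1_seq // => s /andP[/andP[_ Qs] /fw sw]; rewrite sw Qw in Qs.
(* Both index lists are free of duplicates, so only membership has to be compared. *)
apply: perm_big; apply: uniq_perm.
- by rewrite map_inj_uniq ?enum_uniq //; exact: nat_cycles_inj.
- rewrite filter_uniq // uniq_flatten_map ?permutations_uniq // => [w _|w w' _ _ s].
    exact: decs_uniq.
  by rewrite !mem_decs => /andP[/eqP <- _] /andP[/eqP].
move=> s; rewrite mem_filter; apply/mapP/andP => [[p]|[std /flattenP[_ /mapP[w + ->]]]].
  rewrite mem_enum => der ->; have std : derangement_form (nat_cycles p).
    by rewrite derangement_form_nat_cycles.
  split=> //; apply/flattenP; exists (decs (flatten (nat_cycles p))).
    by rewrite map_f // mem_permutations -mem_nat_cycles ?codom_f.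
  rewrite mem_decs eqxx; elim: (nat_cycles p) std => //= c t IHt /and3P[sc _ /IHt].
  by rewrite inE negb_or => ->; case: c sc.
rewrite mem_permutations mem_decs => pw /andP[/eqP fs _]; rewrite -fs in pw.
move: pw; rewrite -mem_nat_cycles // => /codomP[p sE]; exists p => //.
by rewrite mem_enum; have : derangement p by rewrite -derangement_form_nat_cycles -sE.
Qed.

(** Let [b] be the head of [u]. If [a] is at least b + 2, the letter b + 1 occurs later in [u] and
    completes a 31-2. If a = b + 1, no value lies between the first two letters; if [a] is smaller,
    they form an ascent. *)
Lemma avoids_cons_bump n a u :
    perm_eq u (iota 0 n.+1) -> (a <= n.+1)%N ->
  avoids (a :: map (bump a) u) = (a <= (head 0%N u).+1)%N && avoids u.
Proof.
move=> pu an; rewrite [LHS]/= (avoids_map (bump_ltn_mono a)); congr (_ && _).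
have -> : head a (map (bump a) u) = bump a (head 0%N u).
  by case: u pu => // /perm_size.
rewrite has_map; apply/hasPn/idP => [na|ab x _] /=; last by rewrite /bump; lia.
rewrite leqNgt; apply/negP => ab; have /na : (head 0%N u).+1 \in u.
  by rewrite (perm_mem pu) mem_iota; lia.
by rewrite /= /bump; lia.
Qed.

Lemma perm_iota_head_ltn n u : perm_eq u (iota 0 n.+1) -> (head 0%N u < n.+1)%N.
Proof.
case: u => // b u pu; have := mem_head b u.
by rewrite (perm_mem pu) mem_iota.
Qed.

(** The generating tree of avoiding words: a word with head [b] has b + 2 children. *)
Lemma sum_avoiders_cons (V : nmodType) n (F : seq nat -> V) :
  \sum_(w <- permutations (iota 0 n.+2) | avoids w) F w
  = \sum_(u <- permutations (iota 0 n.+1) | avoids u)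
       \sum_(a < (head 0%N u).+2) F (val a :: map (bump a) u).
Proof.
rewrite (perm_big _ (permutations_iotaS n.+1)) big_mkcond.
rewrite big_allpairs_dep exchange_big [RHS]big_mkcond.
apply: eq_big_seq => u; rewrite mem_permutations => pu.
have hu := perm_iota_head_ltn pu.
rewrite -[iota 0 n.+2]/(index_iota 0 n.+2) big_mkord.
rewrite -big_mkcond; case: ifP => au; last first.
  rewrite big1 // => a; rewrite (avoids_cons_bump pu) ?au ?andbF // -ltnS.
  exact: ltn_ord.
rewrite (big_ord_widen_cond n.+2 xpredT (fun a => F (a :: map (bump a) u))) //.
apply: eq_bigl => a; rewrite (avoids_cons_bump pu) ?au ?andbT // -ltnS.
exact: ltn_ord.
Qed.

Lemma weights_cons_bump a u : (weights (a :: map (bump a) u)).1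
  = (weights u).1 + (weights u).2.
Proof. by rewrite /= (weights_map (bump_ltn_mono a)). Qed.

Lemma weights_cons0 u : (weights (0%N :: map (bump 0) u)).2 = 'X * (weights u).1.
Proof.
rewrite /= (weights_map (bump_ltn_mono 0)) ifT // all_map.
by apply/allP.
Qed.

Lemma weights_consS a u : 0%N \in u -> (weights (a.+1 :: u)).2 = 0.
Proof. by move=> u0 /=; case: ifP => // /allP/(_ _ u0). Qed.

(* The variable of the outer polynomial is v: it records the first letter. *)
Definition first_letter_poly n : {poly {poly rat}} :=
  \sum_(u <- permutations (iota 0 n) | avoids u)
     (weights u).1 *: 'X ^+ head 0%N u.

Local Notation P := first_letter_poly.

Definition marked_sum n : {poly rat} :=
  \sum_(u <- permutations (iota 0 n) | avoids u) (weights u).2.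

Lemma first_letter_poly0 : P 0 = 0.
Proof. by rewrite /P unlock /= scale0r addr0. Qed.

Lemma first_letter_poly1 : P 1 = 1.
Proof. by rewrite /P unlock /= add0r scale1r expr0 addr0. Qed.

Lemma first_letter_polyE1 n :
  (P n).[1] = \sum_(u <- permutations (iota 0 n) | avoids u) (weights u).1.
Proof.
rewrite /P horner_sum; apply: eq_bigr => u _.
by rewrite hornerZ hornerXn expr1n mulr1.
Qed.

(** A marked first letter must be 0, and the letter after it is unmarked. For [n] equal to 0 both
    sides vanish because a last letter cannot be marked. *)
Lemma marked_sumS n : marked_sum n.+1 = 'X * (P n).[1].
Proof.
case: n => [|n].
  by rewrite /marked_sum first_letter_poly0 unlock /= horner0 !mulr0 addr0.
rewrite /marked_sum sum_avoiders_cons first_letter_polyE1 mulr_sumr.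
rewrite big_seq_cond [RHS]big_seq_cond; apply: eq_bigr => u.
rewrite mem_permutations => /andP[pu _].
rewrite big_ord_recl weights_cons0 big1 ?addr0 // => a _.
rewrite weights_consS //; apply/mapP; exists 0%N; last by rewrite /bump.
by rewrite (perm_mem pu) mem_iota.
Qed.

(** A word with head b yields the geometric sum 1 + v + ... + v^(b + 1); multiplying by 1 - v leaves
    1 - v^(b + 2). *)
Lemma first_letter_poly_rec n :
  (1 - 'X) * P n.+2
  = ((P n.+1).[1])%:P - 'X ^+ 2 * P n.+1 + (1 - 'X ^+ 2) * ('X * (P n).[1])%:P.
Proof.
have -> : P n.+2 = \sum_(u <- permutations (iota 0 n.+1) | avoids u)
    ((weights u).1 + (weights u).2)%:P * \sum_(a < (head 0%N u).+2) 'X ^+ a.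
  rewrite /P sum_avoiders_cons; apply: eq_bigr => u _; rewrite mulr_sumr.
  by apply: eq_bigr => a _; rewrite weights_cons_bump mul_polyC.
rewrite -marked_sumS first_letter_polyE1 /marked_sum /P.
rewrite !rmorph_sum /= !mulr_sumr -sumrB -big_split /=.
rewrite big_seq_cond [RHS]big_seq_cond; apply: eq_bigr => u.
rewrite mem_permutations => /andP[pu _].
rewrite -mul_polyC mulrCA -[_ - 'X]opprB mulNr -subrX1 opprB rmorphD /=.
set U := (weights u).1%:P.
(* A nonzero second weight forces the head to be 0, so v^b is 1 in that term. *)
have : 'X ^+ head 0%N u * (weights u).2%:P = (weights u).2%:P :> {poly {poly rat}}.
  have u0 : 0%N \in u by rewrite (perm_mem pu) mem_head.
  case: u u0 {pu U} => [|[|a] u] // u0; rewrite ?expr0 ?mul1r //.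
  by rewrite weights_consS ?mulr0.
rewrite -addn2 exprD; move: ('X ^+ head 0%N u) ((weights u).2%:P) => Y M YM.
transitivity (U * (1 - Y * 'X ^+ 2) + M - (Y * M) * 'X ^+ 2); first by ring.
by rewrite YM; ring.
Qed.

(** The flattened word starts with its smallest letter, so its second letter is the head of the
    tail. Of the offset 2, one unit comes from [bump 0], the other from the alphabet starting at
    1. *)
Lemma a_first_letter_poly n i : a_ n.+2 i.+2 = 'X * (P n.+1)`_i.
Proof.
pose Q w := avoids w && (nth 0%N (map succn w) 1 == i.+2).
transitivity (\sum_(p : {perm 'I_n.+2} | derangement p && Q (flatten (nat_cycles p)))
     'X ^+ mu p : {poly rat}).
  apply: eq_bigl => p; rewrite inE flat_nat_cycles contains_31_2E negbK.
  by rewrite (avoids_map (f := succn)) // andbA.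
rewrite sum_derangements big_mkcondr sum_avoiders_cons /P coef_sum mulr_sumr.
rewrite big_seq_cond [RHS]big_seq_cond; apply: eq_bigr => u.
rewrite mem_permutations => /andP[pu _].
rewrite big_ord_recl weights_cons0 big1 ?addr0 => [|a _].
  rewrite coefZ coefXn /=; case: u pu => [/perm_size //|b u _] /=.
  by rewrite /bump /= eqSS eqSS eq_sym; case: eqP => _; rewrite ?mulr1 ?mulr0.
rewrite weights_consS ?if_same //; apply/mapP; exists 0%N; last by rewrite /bump.
by rewrite (perm_mem pu) mem_iota.
Qed.

Lemma size_first_letter_poly n : (size (P n) <= n)%N.
Proof.
case: n => [|n]; first by rewrite first_letter_poly0 size_poly0.
apply: (leq_trans (size_sum _ _ _)); apply/bigmax_leqP_seq => u.
rewrite mem_permutations => /perm_iota_head_ltn hu _.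
apply: (leq_trans (size_scale_leq _ _)); by rewrite size_polyXn.
Qed.

Lemma sum_D31_2 n : \sum_(p in D31_2 n.+2) 'X ^+ mu p = 'X * (P n.+1).[1].
Proof.
rewrite -marked_sumS /marked_sum -(@sum_derangements n.+1 avoids); apply: eq_bigl => p.
rewrite inE flat_nat_cycles contains_31_2E negbK.
by rewrite (avoids_map (f := succn)).
Qed.

(** * Power series *)

Section FpsMorphisms.
Variable R : comUnitRingType.
Implicit Types (a b : fps R) (r : R).

Lemma fcoef_fpsCM r a n : fcoef (fpsC r * a) n = r * fcoef a n.
Proof.
rewrite fcoefM big_ord_recl /= subn0 big1 ?addr0 // => i _.
by rewrite mul0r.
Qed.

Lemma fcoef_fpsXM a n : fcoef (fpsX * a) n.+1 = fcoef a n.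
Proof.
rewrite fcoefM !big_ord_recl /= mul0r add0r /bump /= mul1r subSS subn0.
by rewrite big1 ?addr0 // => i _; rewrite mul0r.
Qed.

Lemma fcoef_fpsXM0 a : fcoef (fpsX * a) 0 = 0.
Proof. by rewrite fcoefM0 mul0r. Qed.

Lemma fcoef_sum (I : Type) (s : seq I) (F : I -> fps R) n :
  fcoef (\sum_(i <- s) F i) n = \sum_(i <- s) fcoef (F i) n.
Proof. by apply: (big_morph (fun a => fcoef a n)) => //=; rewrite if_same. Qed.

Fact fpsC_zmod_morphism : zmod_morphism (@fpsC R).
Proof. by move=> r t; apply: fpsP => -[|n] //=; rewrite subr0. Qed.

Fact fpsC_monoid_morphism : monoid_morphism (@fpsC R).
Proof.
by split=> // r t; apply: fpsP => n; rewrite fcoef_fpsCM /=; case: ifP; rewrite ?mulr0.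
Qed.

HB.instance Definition _ :=
  GRing.isZmodMorphism.Build R (fps R) (@fpsC R) fpsC_zmod_morphism.
HB.instance Definition _ :=
  GRing.isMonoidMorphism.Build R (fps R) (@fpsC R) fpsC_monoid_morphism.

Lemma fcoef_fpsXnM a n k :
  fcoef (fpsX ^+ n * a) k = if (k < n)%N then 0 else fcoef a (k - n)%N.
Proof.
elim: n k => [|n IHn] [|k]; rewrite ?mul1r ?subn0 // exprS -mulrA.
  by rewrite fcoef_fpsXM0.
by rewrite fcoef_fpsXM IHn ltnS.
Qed.

Lemma fps_eq0_of_fpsXn_dvd a : (forall n, exists b, a = fpsX ^+ n * b) -> a = 0.
Proof.
move=> adv; apply: fpsP => n; have [b ->] := adv n.+1.
by rewrite fcoef_fpsXnM ltnSn /= if_same.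
Qed.

(** The tail of [a] from degree [n], divided by the [n]-th power of the variable; it serves as
    remainder in the kernel argument. *)
Definition fps_shift a n : fps R := Fps (fun k => fcoef a (k + n)%N).

Lemma fps_shiftS a n : fps_shift a n = fpsC (fcoef a n) + fpsX * fps_shift a n.+1.
Proof.
apply: fpsP => -[|k]; rewrite fcoefD ?fcoef_fpsXM0 ?fcoef_fpsXM /= ?addr0 //.
by rewrite add0r addnS.
Qed.

Definition poly_fps (p : {poly R}) : fps R := Fps (fun n => p`_n).

Fact poly_fps_zmod_morphism : zmod_morphism poly_fps.
Proof. by move=> p q; apply: fpsP => n /=; rewrite coefB. Qed.

Fact poly_fps_monoid_morphism : monoid_morphism poly_fps.
Proof.
split=> [|p q]; apply: fpsP => n; first by rewrite fcoef1 /= coef1.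
by rewrite fcoefM /= coefM.
Qed.

HB.instance Definition _ :=
  GRing.isZmodMorphism.Build {poly R} (fps R) poly_fps poly_fps_zmod_morphism.
HB.instance Definition _ :=
  GRing.isMonoidMorphism.Build {poly R} (fps R) poly_fps poly_fps_monoid_morphism.

Lemma poly_fpsX : poly_fps 'X = fpsX.
Proof. by apply: fpsP => n /=; rewrite coefX. Qed.

Lemma poly_fpsC r : poly_fps r%:P = fpsC r.
Proof. by apply: fpsP => n /=; rewrite coefC. Qed.

Lemma fps_natr_unit n : (n%:R : R) \is a GRing.unit -> (n%:R : fps R) \is a GRing.unit.
Proof.
by move=> Un; rewrite fps_unitE -(rmorph_nat (@fpsC R)).
Qed.

End FpsMorphisms.

(** The ring morphism through which identities in x alone pass between [fps rat] and [series]. *)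
Definition xseries (a : fps rat) : series := Fps (fun n => fpsC (fcoef a n)%:P).

Fact xseries_zmod_morphism : zmod_morphism xseries.
Proof.
by move=> a b; apply: fpsP => n; rewrite fcoefD fcoefN /= !rmorphB.
Qed.

Fact xseries_monoid_morphism : monoid_morphism xseries.
Proof.
split=> [|a b]; apply: fpsP => n.
  by case: n => [|n] /=; rewrite ?polyC1 // polyC0 rmorph0.
rewrite fcoefM /= !rmorph_sum; apply: eq_bigr => i _ /=.
by rewrite !rmorphM.
Qed.

HB.instance Definition _ :=
  GRing.isZmodMorphism.Build (fps rat) series xseries xseries_zmod_morphism.
HB.instance Definition _ :=
  GRing.isMonoidMorphism.Build (fps rat) series xseries xseries_monoid_morphism.

Lemma xseriesX : xseries fpsX = sx.
Proof.
by apply: fpsP => n /=; case: eqP; rewrite ?polyC1 // polyC0 rmorph0.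
Qed.

(** * Powers of the Catalan series and Lagrange inversion *)

Definition catalan_fps : fps rat := Fps catalan.

Local Notation c := catalan_fps.

Lemma xseries_catalan : xseries c = Cat. Proof. by []. Qed.

(** Expanding [catalan_sqrt] gives 4x (1 + x C^2 - C) = 0; then 4 is cancelled as a unit and x by a
    shift of coefficients. *)
Lemma Cat_eq : Cat = 1 + sx * Cat ^+ 2.
Proof.
have [E _] := catalan_sqrt.
have U4 : (4%:R : series) \is a GRing.unit.
  do 2!apply: fps_natr_unit.
  by rewrite poly_unitE -polyC_natr size_polyC coefC.
have {}E : sx * (1 + sx * Cat ^+ 2 - Cat) = 0.
  apply: (mulrI U4); rewrite mulr0.
  by transitivity ((1 - 2 * sx * Cat) ^+ 2 - (1 - 4 * sx)); [ring | rewrite E subrr].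
apply/eqP; rewrite eq_sym -subr_eq0; apply/eqP/fpsP => n.
by rewrite -(fcoef_fpsXM (_ - _)) E /= if_same.
Qed.

Lemma catalan_fps_eq : c = 1 + fpsX * c ^+ 2.
Proof.
apply: fpsP => n.
have := congr1 (fun s : series => (fcoef (fcoef s n) 0 : {poly rat})`_0) Cat_eq.
rewrite -xseriesX -xseries_catalan -(rmorphXn xseries) -rmorphM -(rmorph1 xseries) -rmorphD.
by rewrite /= !coefC.
Qed.

(** The ballot-number formula, by induction on [N] and then on [r], using C^(s + 1) = C^s + x C^(s +
    2). *)
Lemma fcoef_catalanX N r :
  N.+1%:R * fcoef (c ^+ r) N.+1 = r%:R * 'C(2 * N + r + 1, N)%:R.
Proof.
have step m s : fcoef (c ^+ s.+1) m.+1 = fcoef (c ^+ s) m.+1 + fcoef (c ^+ s.+2) m.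
  rewrite -(fcoef_fpsXM (c ^+ s.+2)) -fcoefD; congr (fcoef _ _).
  by rewrite exprS {1}catalan_fps_eq -[s.+2]addn2 exprD; ring.
have c0 s : fcoef (c ^+ s) 0 = 1.
  elim: s => // s IHs; rewrite exprS fcoefM0 IHs mulr1 /= /catalan bin0.
  by rewrite divr1.
elim: N r => [|N IHN]; elim=> [|r IHr]; rewrite ?expr0 ?fcoef1 ?mulr0 ?mul0r //.
  rewrite step c0 mulrDr IHr !bin0 -[r.+1]addn1 natrD; ring.
have nzN : N.+1%:R != 0 :> rat by rewrite Num.Theory.pnatr_eq0.
apply: (mulfI nzN); rewrite step mulrDr [RHS]mulrCA.
have -> : (2 * N.+1 + r.+1 + 1 = (2 * N + r + 3).+1)%N by lia.
have := IHN r.+2; have := IHr.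
have -> : (2 * N.+1 + r + 1 = 2 * N + r + 3)%N by lia.
have -> : (2 * N + r.+2 + 1 = 2 * N + r + 3)%N by lia.
have := congr1 (fun m => m%:R : rat) (mul_bin_left (2 * N + r + 3) N).
have -> : (2 * N + r + 3 - N = N + r + 3)%N by lia.
rewrite binS !natrM !natrD -![_.+1%:R]natr1.
move: 'C(_, N)%:R 'C(_, N.+1)%:R (fcoef _ _) (fcoef _ _) => B B' x y E Ex Ey.
rewrite Ex mulrDr [_ * (_ * x)]mulrCA Ey.
transitivity (r%:R * ((N%:R + 1) * B') + (N%:R + 1 + 1) * ((r%:R + 1 + 1) * B)).
  by ring.
rewrite [RHS](_ : _ = (r%:R + 1) * ((N%:R + 1) * B')
                        + (r%:R + 1) * ((N%:R + 1) * B)); last by ring.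
by rewrite E; ring.
Qed.

Lemma coef_X1n (n i : nat) : (('X + 1) ^+ n : {poly rat})`_i = 'C(n, i)%:R.
Proof.
rewrite exprD1n coef_sum.
under eq_bigr do rewrite coefMn coefXn.
case: (ltnP i n.+1) => [lt_in|lt_ni]; last first.
  rewrite bin_small // big1 // => j _; case: eqP => [ij|]; last by rewrite mul0rn.
  by have := ltn_ord j; rewrite -ij ltnNge lt_ni.
rewrite (bigD1 (Ordinal lt_in)) //= eqxx big1 ?addr0 // => j nj.
case: eqP => [ij|]; last by rewrite mul0rn.
by case/eqP: nj; apply: val_inj.
Qed.

(* Lagrange inversion for the equation z = x (1 + z)^2 solved by z = C - 1. *)
Lemma catalan_Lagrange (H : {poly rat}) N :
  N.+1%:R * fcoef (map_poly (@fpsC rat) H).[c] N.+1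
  = ((H^`() \Po ('X + 1)) * ('X + 1) ^+ (2 * N.+1))`_N.
Proof.
(* Both sides are linear in [H], so monomials suffice, and for these the claim is
   [fcoef_catalanX]. *)
rewrite -[H]coefK poly_def; elim/big_ind: _ => [|p q Ep Eq|i _].
- by rewrite rmorph0 horner0 linear0 comp_poly0 mul0r coef0 mulr0.
- by rewrite rmorphD hornerD fcoefD mulrDr Ep Eq linearD rmorphD /= mulrDl coefD.
rewrite map_polyZ map_polyXn hornerZ hornerXn fcoef_fpsCM mulrCA fcoef_catalanX.
rewrite linearZ /= derivXn comp_polyZ -scalerAl coefZ; congr (_ * _).
case: (val i) => [|r]; first by rewrite !mulr0n comp_poly0 !mul0r coef0.
rewrite mulr_natl raddfMn /= comp_Xn_poly mulrnAl -exprD coefMn coef_X1n.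
by congr ('C(_, _)%:R *+ _); rewrite /=; lia.
Qed.

Lemma coef_X1_sqr_sub1 (k s i : nat) :
  (((('X + 1) ^+ 2 - 1) ^+ k * ('X + 1) ^+ s) : {poly rat})`_i
  = \sum_(j < k.+1) (-1) ^+ j * 'C(k, j)%:R * 'C(2 * (k - j) + s, i)%:R.
Proof.
rewrite exprBn mulr_suml coef_sum; apply: eq_bigr => j _.
rewrite expr1n mulr1 mulrnAl coefMn -[_ * _ * ('X + 1) ^+ s]mulrA -exprM -exprD.
rewrite [RHS]mulrAC -!(signr_odd _ j).
by case: (odd j);
  rewrite ?expr1 ?expr0 ?mul1r ?mulN1r ?coefN coef_X1n ?mulNr mulr_natr ?mulNrn.
Qed.

(** Lagrange inversion with H = (X - 1) (X^2 - 1)^k. The two terms of the product rule for H' give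
    the two sums. *)
Lemma fcoef_catalan_prod k N : (k <= N)%N ->
  fcoef ((c - 1) * (c ^+ 2 - 1) ^+ k) N.+1
  = (2 * k)%:R / N.+1%:R
    * (\sum_(j < k) (-1) ^+ j * 'C(k - 1, j)%:R
                      * 'C(2 * (N + k) + 1 - 2 * j, N - 1)%:R)
    + 1 / N.+1%:R
    * (\sum_(j < k.+1) (-1) ^+ j * 'C(k, j)%:R * 'C(2 * (N + k) + 2 - 2 * j, N)%:R).
Proof.
move=> kN; have nzN : N.+1%:R != 0 :> rat by rewrite Num.Theory.pnatr_eq0.
set S1 := \sum_(j < k) _; set S2 := \sum_(j < k.+1) _.
apply: (mulfI nzN).
have clear_denom (d e x y : rat) : d != 0 -> d * (e / d * x + 1 / d * y) = e * x + y.
  by move=> d0; field.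
rewrite clear_denom //.
have := catalan_Lagrange (('X - 1) * ('X ^+ 2 - 1) ^+ k) N.
rewrite !rmorphM /= !(rmorphXn, rmorphB) /= !(map_polyX, rmorph1, map_polyXn).
rewrite hornerM horner_exp !hornerE => ->.
have d1 : (1 : {poly rat})^`() = 0 by rewrite -polyC1 derivC.
have -> : (('X - 1) * ('X ^+ 2 - 1) ^+ k)^`() \Po ('X + 1)
    = (('X + 1) ^+ 2 - 1) ^+ k
      + 'X * ((('X + 1) ^+ 2 - 1) ^+ k.-1 * ('X + 1)) *+ (2 * k) :> {poly rat}.
  rewrite derivM !derivB derivX d1 !subr0 mul1r deriv_exp !derivB derivXn d1 subr0.
  rewrite mulrnAl -mulrnA mulrnAr expr1 comp_polyD raddfMn /= !comp_polyM.
  rewrite !(rmorphXn (comp_poly _)) /= !comp_polyB !comp_Xn_poly !comp_polyX.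
  by rewrite -polyC1 !comp_polyC polyC1 addrK [('X + 1) * _]mulrC.
rewrite mulrDl coefD addrC coef_X1_sqr_sub1; congr (_ + _); last first.
  by apply: eq_bigr => j _; congr (_ * 'C(_, _)%:R); have := ltn_ord j; lia.
case: k kN @S1 @S2 => [|k] kN S1 _; first by rewrite mulr0n mul0r coef0 mul0r.
rewrite mulrnAl coefMn -[LHS]mulr_natl; congr (_ * _).
(* The factor X lowers the index to [N - 1]; the bound on [k] excludes [N] equal to 0. *)
rewrite -!mulrA -exprS coefXM; case: N kN @S1 {nzN} => // N kN S1.
rewrite coef_X1_sqr_sub1 /S1 !subn1 /=; apply: eq_bigr => j _.
by congr (_ * 'C(_, _)%:R); have := ltn_ord j; lia.
Qed.

(** * Functional equation relating F(x, v), which is [Fseries], to F(x, 1), which is [Gseries] *)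

Definition Fseries : series := Fps (fun n => poly_fps (P n)).

Definition Gseries : series := Fps (fun n => fpsC (P n).[1]).

Lemma A_Fseries : A = sx * sy * Fseries.
Proof.
apply: fpsP => -[|[|n]]; rewrite -mulrA ?fcoef_fpsXM0 ?fcoef_fpsXM ?fcoef_fpsCM //.
  by rewrite /= first_letter_poly0 rmorph0 mulr0.
rewrite [LHS]/= big_add1 big_add1 /= big_mkord.
apply: fpsP => i; rewrite fcoef_fpsCM fcoef_sum [fcoef (fcoef Fseries _) _]/=.
(* Only the index [j] equal to [i] contributes to the coefficient of v^i; beyond the range the
   degree bound makes both sides zero. *)
rewrite (eq_bigr (fun j : 'I_n.+1 => if i == j then 'X * (P n.+1)`_i else 0)); last first.
  move=> j _; rewrite a_first_letter_poly fcoef_fpsCM !subSS subn0.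
  rewrite -[fpsX ^+ _]mulr1 fcoef_fpsXnM fcoef1 subn_eq0.
  by case: ltngtP => [_|_|->]; rewrite ?mulr0 ?mulr1.
rewrite -big_mkcond /=; case: (ltnP i n.+1) => [i_n|n_i].
  by apply: (@big_pred1 _ _ _ _ (Ordinal i_n)) => j; rewrite /= eq_sym.
rewrite big_pred0 => [|j]; last by apply/negbTE; have := ltn_ord j; lia.
by rewrite nth_default ?mulr0 // (leq_trans (size_first_letter_poly _)).
Qed.

Lemma Fseries_eq :
  (1 - sv + sx * sv ^+ 2) * Fseries
  = sx * (1 - sv) + sx * (1 + sx * sy * (1 - sv ^+ 2)) * Gseries.
Proof.
(* Powers of x are pulled to the front so that coefficients can be read off by shifts; from degree 2
   on they are [first_letter_poly_rec]. *)
transitivity (fpsC (1 - fpsX) * Fseries + fpsX * (fpsC (fpsX ^+ 2) * Fseries)).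
  by rewrite rmorphB rmorph1 rmorphXn -/sv -/sx; ring.
transitivity (fpsX * (fpsC (1 - fpsX) + Gseries
                 + fpsX * (fpsC (fpsC 'X * (1 - fpsX ^+ 2)) * Gseries)) : series); last first.
  by rewrite rmorphM !rmorphB !rmorph1 rmorphXn -/sv -/sx -/sy; ring.
apply: fpsP => -[|[|n]]; rewrite !fcoefD ?fcoef_fpsXM0 ?fcoef_fpsXM ?fcoef_fpsCM.
- by rewrite /= first_letter_poly0 rmorph0 mulr0 addr0.
- rewrite !fcoefD ?fcoef_fpsXM0 ?fcoef_fpsCM /= first_letter_poly0 first_letter_poly1.
  by rewrite horner0 !rmorph0 rmorph1 mulr1 mulr0 !addr0.
rewrite !fcoefD fcoef_fpsXM fcoef_fpsCM /= add0r.
have /= := congr1 (@poly_fps _) (first_letter_poly_rec n).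
rewrite !(rmorphD, rmorphN, rmorphM, rmorphXn, rmorph1) /= !poly_fpsX !poly_fpsC => ->.
by ring.
Qed.

(* Kernel method: at v = C the factor 1 - v + x v^2 vanishes. *)
Lemma Gseries_eq : (1 - sx * sy * (Cat ^+ 2 - 1)) * Gseries = Cat - 1.
Proof.
pose cst (r : {poly rat}) : series := fpsC (fpsC r).
(* Each coefficient polynomial is evaluated at v = C separately; telescoping the recurrence replaces
   substitution into the whole series. *)
pose ev p := (map_poly (@fpsC _ \o @fpsC _) p).[Cat] : series.
pose Sh := fps_shift Gseries.
have ShS n : Sh n = cst (P n).[1] + sx * Sh n.+1 by exact: fps_shiftS.
have Sh0 : Gseries = Sh 0%N.
  by apply: fpsP => n /=; rewrite addn0.
have KC : 1 - Cat = - (sx * Cat ^+ 2) by rewrite {1}Cat_eq; ring.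
have evS n : Cat ^+ 2 * ev (P n.+1) = sx * (Cat ^+ 2 * ev (P n.+2))
    + cst (P n.+1).[1] + (1 - Cat ^+ 2) * (sy * cst (P n).[1]).
  have /= := congr1 ev (first_letter_poly_rec n).
  rewrite /ev !(rmorphD, rmorphN, rmorphM, rmorphXn, rmorph1) /=.
  rewrite !(map_polyX, map_polyC, hornerD, hornerN, hornerM, hornerC, hornerX, horner_exp) /=.
  rewrite KC -/sy -!/(cst _) => /eqP; rewrite -subr_eq0 => /eqP E.
  by apply/eqP; rewrite -subr_eq0; apply/eqP; rewrite -[RHS]E; ring.
(* Iterating [evS] shows that the fixed left-hand side is divisible by every power of x, hence
   zero. *)
have D n : sx * Cat ^+ 2 - Gseries - (1 - Cat ^+ 2) * (sx * sy * Gseries)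
  = sx ^+ n.+1 * (Cat ^+ 2 * ev (P n.+1) - Sh n.+1 - (1 - Cat ^+ 2) * (sy * Sh n)).
  elim: n => [|n ->].
    have ev1 : ev (P 1) = 1 by rewrite first_letter_poly1 /ev rmorph1 hornerC.
    have Sh01 : Sh 0%N = sx * Sh 1%N.
      by rewrite ShS first_letter_poly0 horner0 /cst !rmorph0 add0r.
    by rewrite ev1 Sh0 Sh01; ring.
  by rewrite evS (ShS n) {1}(ShS n.+1) [sx ^+ n.+2]exprS; ring.
apply/eqP; rewrite eq_sym -subr_eq0; apply/eqP.
transitivity (sx * Cat ^+ 2 - Gseries - (1 - Cat ^+ 2) * (sx * sy * Gseries)).
  by rewrite -[Cat - 1]opprB KC; ring.
apply: fps_eq0_of_fpsXn_dvd => -[|n]; last by rewrite (D n); eexists.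
by rewrite expr0; eexists; rewrite mul1r.
Qed.

(** Unfolding G = (C - 1) + x y (C^2 - 1) G [k] times extracts y^k, each y bringing one x. The
    factor [a] absorbs the powers of C^2 - 1 during the induction. *)
Lemma coef_Gseries (a : fps rat) n k :
  (fcoef (fcoef (xseries a * Gseries) (n + k)) 0)`_k
  = fcoef (a * ((c - 1) * (c ^+ 2 - 1) ^+ k)) n.
Proof.
have GE : Gseries = xseries (c - 1) + sx * (sy * (xseries (c ^+ 2 - 1) * Gseries)).
  rewrite !rmorphB rmorphXn rmorph1 /= xseries_catalan -Gseries_eq; ring.
have coefx (b : fps rat) m j : (fcoef (fcoef (xseries b) m) 0)`_j
    = if j == 0%N then fcoef b m else 0.
  by rewrite /= coefC.
have aGE b : xseries b * Gseries = xseries (b * (c - 1))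
    + sx * (sy * (xseries (b * (c ^+ 2 - 1)) * Gseries)).
  by rewrite {1}GE !rmorphM; ring.
elim: k a n => [|k IHk] a n; rewrite aGE !fcoefD coefD coefx.
  rewrite addn0 mulr1; case: n => [|n]; rewrite ?fcoef_fpsXM0 ?fcoef_fpsXM.
    by rewrite coef0 addr0.
  by rewrite !fcoef_fpsCM coefXM addr0.
rewrite add0r addnS fcoef_fpsXM !fcoef_fpsCM coefXM.
apply: etrans (IHk _ _) _; rewrite [_ ^+ k.+1]exprS.
by congr (fcoef _ _); ring.
Qed.

(** The marked initial letter accounts for one x and one y, leaving the coefficient of x^(N + 1 + k)
    y^k in [Gseries]. *)
Lemma card_D31_2 n k N : n = (N + k).+2 ->
  #|[set p in D31_2 n | mu p == k.+1]|%:R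
  = fcoef ((c - 1) * (c ^+ 2 - 1) ^+ k) N.+1 :> rat.
Proof.
move=> ->; rewrite -[_ * _]mul1r -coef_Gseries rmorph1 mul1r /=.
have := congr1 (fun p : {poly rat} => p`_k.+1) (sum_D31_2 (N + k)).
rewrite coefXM /= addSn => <-; rewrite coef_sum -sum1_card natr_sum.
rewrite [RHS]big_mkcond [LHS]big_mkcond /=; apply: eq_bigr => p _.
by rewrite inE coefXn eq_sym; case: (p \in _); case: eqP.
Qed.

Theorem theorem2p4 :
  A = sx ^+ 2 * sy * (1 - sv) / (1 - sv + sx * sv ^+ 2)
      + sx ^+ 2 * sy * (1 + sx * sy - sx * sy * sv ^+ 2) * (Cat - 1)
        / ((1 - sv + sx * sv ^+ 2) * (1 - sx * sy * (Cat ^+ 2 - 1)))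
  /\
  forall n m : nat, (2 <= n)%N -> (1 <= m <= n %/ 2)%N ->
    #|[set p in D31_2 n | mu p == m]|%:R
    = (2 * (m - 1))%:R / (n - m)%:R
        * (\sum_(j < m - 1)
             (-1) ^+ j * 'C(m - 2, j)%:R * 'C(2 * n - 2 * j - 3, n - m - 2)%:R)
      + 1 / (n - m)%:R
        * (\sum_(j < m)
             (-1) ^+ j * 'C(m - 1, j)%:R * 'C(2 * n - 2 * j - 2, n - m - 1)%:R)
      :> rat.
Proof.
split=> [|n m n2 /andP[m1 mn]].
  rewrite A_Fseries invrM ?denom1_unit ?denom2_unit //.
  have -> : Fseries = (sx * (1 - sv) + sx * (1 + sx * sy * (1 - sv ^+ 2)) * Gseries)
      / (1 - sv + sx * sv ^+ 2).
    by rewrite -Fseries_eq mulrC mulKr ?denom1_unit.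
  have -> : Gseries = (Cat - 1) / (1 - sx * sy * (Cat ^+ 2 - 1)).
    by rewrite -Gseries_eq mulrC mulKr ?denom2_unit.
  by move: (_ ^-1) (_ ^-1) => u v; ring.
case: m m1 mn => // k _ mn.
have mn2 : (2 * k.+1 <= n)%N by lia.
(* With m = k + 1 this makes N + 1 = n - m, and m <= n / 2 becomes k <= N. *)
pose N := (n - k.+2)%N; have nE : n = (N + k).+2 by rewrite /N; lia.
rewrite (card_D31_2 nE) fcoef_catalan_prod; last by lia.
have -> : (n - k.+1 = N.+1)%N by lia.
rewrite !subSS !subn0; congr (_ * _ + _ * _); apply: eq_bigr => j _.
- by congr (_ * 'C(_, _)%:R * 'C(_, _)%:R); lia.
- by congr (_ * 'C(_, _)%:R); lia.
Qed.
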